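(* There is an absolute constant $C>0$ such that for every $k,L \in \mathbb{N}$ there exists a polynomial $\mathrm{p}$ of degree at most $C\cdot k^3\cdot L$ with the following property: for every $k$-creature-free graph $G$, the number of minimal separators $S$ of $G$ satisfying $\zeta_G(S)\le L$ is at most $\mathrm{p}(|V(G)|)$.
   Context: All graphs are finite and simple. For $S\subseteq V(G)$, a connected component $A$ of $G-S$ is full to $S$ if $N(A)=S$. A set $S \subseteq V(G)$ is a minimal separator of $G$ if $G-S$ has at least two connected components that are full to $S$. For $S\subseteq V(G)$, $\zeta_G(S)$ is the maximum size of a set $I\subseteq S$ such that $I$ is independent in $G$ and every vertex $v \in V(G)\setminus S$ satisfies $|N(v)\cap I|\le 1$. A $k$-creature in $G$ is a tuple $(A,B,X,Y)$ of pairwise disjoint nonempty subsets of $V(G)$ such that: (i) $G[A]$ and $G[B]$ are connected; (ii) there are no edges between $A$ and $Y\cup B$, and no edges between $B$ and $A\cup X$; (iii) every $x\in X$ has a neighbor in $A$ and every $y \in Y$ has a neighbor in $B$; (iv) $|X|=|Y|=k$ and one can enumerate $X=\{x_1,\dots,x_k\}$, $Y=\{y_1,\dots,y_k\}$ so that $x_iy_j\in E(G)$ if and only if $i=j$. $G$ is $k$-creature-free if it has no $k$-creature. *)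

(* Defs.v *)
From mathcomp Require Import all_boot.

Set Implicit Arguments.
Unset Strict Implicit.
Unset Printing Implicit Defensive.

(* A finite simple graph is given by a finType of vertices T and an adjacency
   relation e : rel T; symmetry and irreflexivity of e are hypotheses of the
   statements, not of the definitions below. *)

Section Graph.

Variables (T : finType) (e : rel T).
Implicit Types (S A B X Y I : {set T}) (v : T) (k : nat).

Definition nbh v : {set T} := [set u | e v u].

(* Open neighbourhood: vertices outside A with a neighbour in A. *)
Definition Nbh A : {set T} := [set v in ~: A | [exists u in A, e u v]].

Definition induced A : rel T := [rel x y in A | e x y].

Definition connected_set A : bool :=
  (A != set0) && [forall x in A, forall y in A, connect (induced A) x y].

(* Vertex sets of the connected components of G - S. *)
Definition components_off S : {set {set T}} :=
  equivalence_partition (connect (induced (~: S))) (~: S).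

Definition full_components S : {set {set T}} :=
  [set A in components_off S | Nbh A == S].

Definition minimal_separator S : bool := 2 <= #|full_components S|.

Definition independent I : bool := [forall u in I, forall v in I, ~~ e u v].

Definition zeta S : nat :=
  \max_(I : {set T} | [&& I \subset S, independent I
                        & [forall v in ~: S, #|nbh v :&: I| <= 1]]) #|I|.

Definition anticomplete A B : bool := [forall u in A, forall v in B, ~~ e u v].

Record is_creature k A B X Y : Prop := IsCreature {
  creature_nonempty : [/\ A != set0, B != set0, X != set0 & Y != set0];
  creature_disjoint : [&& [disjoint A & B], [disjoint A & X], [disjoint A & Y],
                          [disjoint B & X], [disjoint B & Y] & [disjoint X & Y]];
  creature_connected : connected_set A /\ connected_set B;
  creature_anticomplete : anticomplete A (Y :|: B) /\ anticomplete B (A :|: X);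
  creature_attached : (forall x, x \in X -> exists2 a, a \in A & e x a) /\
                      (forall y, y \in Y -> exists2 b, b \in B & e y b);
  creature_card : #|X| = k /\ #|Y| = k;
  (* The enumerations are injective by creature_card. *)
  creature_matching : exists x y : 'I_k -> T,
    [/\ X = [set x i | i : 'I_k], Y = [set y i | i : 'I_k]
      & forall i j, e (x i) (y j) = (i == j)]
}.

Definition creature_free k : Prop :=
  ~ exists A B X Y : {set T}, is_creature k A B X Y.

End Graph.

(* Main.v *)
(* Let S be a minimal separator with full components A and B.  Call N(s) & N(C),
   for C connected and anticomplete to s, a trace.  By creature-freeness a trace
   is determined by s, a vertex of C and fewer than k neighbors of s, so there
   are n^O(k) traces; N(v) & S is a trace for every v outside S.
   Fix a root r in A and let d(s) be the distance within A from r to the nearest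
   neighbor of s.  Each level of d is dominated by at most k vertices of A.
   Vertices s, t of S conflict if they are adjacent or share a neighbor outside
   S.  The t with d(t) <= d(s) - 2 sharing a neighbor outside S with s but not
   adjacent to s are dominated by fewer than k vertices outside S; those
   adjacent to s lie in the trace of s on the ball of radius d(s) - 2.  Choosing
   conflict-free vertices greedily by decreasing d gives at most zeta(S) <= L of
   them, so S is covered by the neighborhoods of O(kL) vertices outside S and by
   L traces contained in A + S.  Intersecting the latter with the analogous
   traces on the B side leaves only vertices of S, so S is described by O(kL)
   traces, which leaves n^O(k^2 L) possibilities. *)
Require Import Defs.
From mathcomp Require Import all_boot all_order all_algebra.
From mathcomp Require Import zify.
Import Order.TTheory GRing.Theory Num.Theory.
Local Open Scope ring_scope.

Section CreatureFree.

Set Implicit Arguments.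
Unset Strict Implicit.
Unset Printing Implicit Defensive.
Local Open Scope nat_scope.

Context {T : finType}.
Variable e : rel T.
Hypotheses (e_sym : symmetric e) (e_irr : irreflexive e).

(** * Neighborhoods, connected sets and components *)

Lemma anticompleteP (A B : {set T}) :
  reflect (forall a b, a \in A -> b \in B -> ~~ e a b) (anticomplete e A B).
Proof.
apply: (iffP idP) => [/forall_inP H a b aA bB|H].
  by have /forall_inP := H a aA; apply.
by apply/forall_inP => a aA; apply/forall_inP => b; apply: H.
Qed.

Lemma NbhP (A : {set T}) v :
  reflect (v \notin A /\ exists2 u, u \in A & e u v) (v \in Nbh e A).
Proof.
rewrite !inE; apply: (iffP andP) => [[vA /exists_inP H]|[vA H]]; split=> //.
exact/exists_inP.
Qed.

Lemma connected_setP (A : {set T}) :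
  reflect (A != set0 /\ {in A &, forall x y, connect (induced e A) x y})
    (connected_set e A).
Proof.
apply: (iffP andP) => [[A0 /forall_inP H]|[A0 H]]; split=> //.
  by move=> x y xA yA; have /forall_inP := H x xA; apply.
by apply/forall_inP => x xA; apply/forall_inP => y yA; apply: H.
Qed.

Lemma connected_set1 v : connected_set e [set v].
Proof.
apply/connected_setP; split; first by apply/set0Pn; exists v; rewrite inE.
by move=> x y /set1P-> /set1P->.
Qed.

Lemma induced_sym (A : {set T}) : symmetric (induced e A).
Proof. by move=> x y; rewrite /induced /= e_sym (andbC (x \in A)). Qed.

Lemma sub_connect_induced (A B : {set T}) x y :
  A \subset B -> connect (induced e A) x y -> connect (induced e B) x y.
Proof.
move=> /subsetP sAB; apply: connect_sub => {}x {}y /andP[/andP[xA yA] exy].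
by apply: connect1; rewrite /induced /= !sAB.
Qed.

Lemma connected_setU (A B : {set T}) a :
    a \in A -> connected_set e A ->
    (forall b, b \in B -> exists2 u, u \in A & e u b) ->
  connected_set e (A :|: B).
Proof.
move=> aA /connected_setP[_ cA] AB; apply/connected_setP.
split; first by apply/set0Pn; exists a; rewrite inE aA.
have to_a x : x \in A :|: B -> connect (induced e (A :|: B)) a x.
  have inA y : y \in A -> connect (induced e (A :|: B)) a y.
    by move=> yA; apply: sub_connect_induced (cA _ _ aA yA); apply: subsetUl.
  rewrite inE => /orP[/inA//|xB]; have [u uA eux] := AB x xB.
  apply: connect_trans (inA u uA) (connect1 _).
  by rewrite /induced /= !inE uA xB orbT.
move=> x y /to_a ax /to_a; apply: connect_trans.
by rewrite sym_connect_sym //; apply: induced_sym.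
Qed.

Lemma connect_inv (P : T -> Prop) (r : rel T) x y :
    (forall u v, P u -> r u v -> P v) -> connect r x y -> P x -> P y.
Proof.
move=> closedP /connectP[p pth ->].
elim: p x pth => //= z p IHp x /andP[rxz pth] Px.
by apply: IHp => //; apply: closedP rxz.
Qed.

Lemma connected_component (D : {set T}) c :
  c \in D -> connected_set e [set x | connect (induced e D) c x].
Proof.
move=> cD; set K := [set x | _].
have to_c x : x \in K -> connect (induced e K) c x.
  suff sub : [set x | connect (induced e D) c x]
             \subset [set x | connect (induced e K) c x].
    by move=> xK; have := subsetP sub x xK; rewrite inE.
  apply/subsetP => z; rewrite inE => cz.
  (* Membership in [K] is carried along with reachability inside [K], so that each further edge is
     known to have both ends in [K]. *)
  have: z \in K :&: [set x | connect (induced e K) c x].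
    apply: (@connect_inv (fun z => z \in K :&: _) _ _ _ _ cz); last by rewrite !inE !connect0.
    move=> u v /setIP[uK]; rewrite !inE => cu Duv.
    have cv : connect (induced e D) c v.
      by apply: connect_trans (connect1 Duv); move: uK; rewrite inE.
    rewrite cv; apply: connect_trans cu (connect1 _).
    by case/andP: Duv => _ euv; rewrite /induced /= uK euv inE cv.
  by case/setIP.
apply/connected_setP; split.
  by apply/set0Pn; exists c; rewrite inE connect0.
move=> x y /to_c cx /to_c; apply: connect_trans.
by rewrite sym_connect_sym //; apply: induced_sym.
Qed.

(** * Small dominating sets from creature-freeness *)

(* A minimal dominating subset of [P] and its private neighbors in [R] are the
   matching of a creature with sides [A] and [B]. *)
Lemma dominating_lt k (A B P R : {set T}) :
    0 < k -> creature_free e k ->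
    connected_set e A -> connected_set e B -> [disjoint A & B] ->
    anticomplete e A B -> anticomplete e B P -> anticomplete e A R ->
    (forall p, p \in P -> exists2 a, a \in A & e p a) ->
    (forall r, r \in R -> exists2 b, b \in B & e r b) ->
    (forall r, r \in R -> exists2 p, p \in P & e p r) ->
  exists U : {set T}, [/\ U \subset P, #|U| < k &
    forall r, r \in R -> exists2 u, u \in U & e u r].
Proof.
move=> k_gt0 cfree cA cB dAB /anticompleteP aAB /anticompleteP aBP.
move=> /anticompleteP aAR PA RB RP.
pose dom (U : {set T}) := [forall r in R, exists u in U, e u r].
have /minset_exists[U /minsetP[domU minU] sUP] : dom P.
  by apply/forall_inP => r /RP[p pP epr]; apply/exists_inP; exists p.
have RU r : r \in R -> exists2 u, u \in U & e u r.
  by move=> rR; apply/exists_inP; apply: (forall_inP domU).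
exists U; split=> //; rewrite ltnNge; apply/negP => kU; apply: cfree.
(* By minimality, removing [u] leaves some vertex of [R] undominated; that vertex sees [u] and
   nothing else in [U]. *)
have priv u : u \in U ->
    exists y, y \in R /\ forall v, v \in U -> e v y = (v == u).
  move=> uU; have /forall_inPn[y yR /exists_inPn noy] : ~~ dom (U :\ u).
    apply/negP => d; have := minU _ d (subsetDl _ _) => /setP/(_ u).
    by rewrite setD11 uU.
  have other v : v \in U -> v != u -> e v y = false.
    by move=> vU vu; apply/negbTE/noy; rewrite !inE vu.
  exists y; split=> // v vU; have [->|/other->//] := eqVneq v u.
  have [w wU ewy] := RU y yR; have [<-|wu] := eqVneq w u; first by rewrite ewy.
  by rewrite other in ewy.
(* Any [k] elements of [U] would do; privacy over all of [U] restricts to them. *)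
pose x (i : 'I_k) := enum_val (widen_ord kU i).
have xU i : x i \in U by apply: enum_valP.
have x_inj : injective x.
  by move=> i j /enum_val_inj/(congr1 val)/= ij; apply: val_inj.
have [y yP] := fin_all_exists (fun i => priv (x i) (xU i)).
have exy i j : e (x i) (y j) = (i == j).
  by rewrite (proj2 (yP j)) // (inj_eq x_inj).
have y_inj : injective y.
  by move=> i j yij; apply/eqP; rewrite -exy -yij exy.
have yR i : y i \in R by case: (yP i).
have xP i : x i \in P by apply: (subsetP sUP).
have ne (f : 'I_k -> T) : [set f i | i : 'I_k] != set0.
  by apply/set0Pn; exists (f (Ordinal k_gt0)); apply: imset_f.
have [A0 _] := connected_setP _ cA; have [B0 _] := connected_setP _ cB.
exists A, B, [set x i | i : 'I_k], [set y i | i : 'I_k]; split.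
- by split.
- have dis (C : {set T}) (f : 'I_k -> T) :
    (forall i, f i \notin C) -> [disjoint C & [set f i | i : 'I_k]].
    move=> fC; rewrite disjoints_subset; apply/subsetP => z zC; rewrite inE.
    by apply/imsetP => -[i _ zi]; have := fC i; rewrite -zi zC.
  rewrite dAB /=; apply/and5P; split; apply: dis => i.
  + by apply/negP => /aAR/(_ (yR i)); rewrite exy eqxx.
  + by apply/negP => /aAB yA; have [b bB eyb] := RB _ (yR i); have := yA _ bB; rewrite eyb.
  + by apply/negP => xB; have [a aA exa] := PA _ (xP i); have := aAB _ _ aA xB; rewrite e_sym exa.
  + by apply/negP => /aBP/(_ (xP i)); rewrite e_sym exy eqxx.
  + apply/imsetP => -[j _ yx]; have [b bB eyb] := RB _ (yR i).
    by have := aBP _ _ bB (xP j); rewrite -yx e_sym eyb.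
- by split.
- split; apply/anticompleteP => a b aA /setUP[].
  + by case/imsetP => i _ ->; apply: aAR.
  + exact: aAB.
  + by rewrite e_sym => bA; apply: aAB.
  + by case/imsetP => i _ ->; apply: aBP.
- by split=> _ /imsetP[i _ ->]; [apply: PA|apply: RB].
- by rewrite !card_imset ?card_ord.
- by exists x, y.
Qed.

(** * Traces and their number *)

(** If [c] is itself among the removed vertices, reflexivity of [connect] leaves just the singleton
    of [c], so every choice of parameters encodes some set. *)
Definition component_avoiding (s c : T) (F : {set T}) : {set T} :=
  [set x | connect
     (induced e (~: (s |: nbh e s :|: \bigcup_(f in F) nbh e f))) c x].

Definition trace s c F : {set T} := nbh e s :&: Nbh e (component_avoiding s c F).

(* The vertices outside [N[s]] reached by [C] without crossing
   [N(N(s) \ N(C))] form a component whose boundary is dominated by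
   [N(s) \ N(C)], hence, by creature-freeness, by few of its vertices. *)
Lemma trace_connected k s (C : {set T}) :
    0 < k -> creature_free e k ->
    connected_set e C -> s \notin C -> anticomplete e [set s] C ->
  exists c, exists2 F : {set T}, #|F| < k & nbh e s :&: Nbh e C = trace s c F.
Proof.
move=> k_gt0 cfree cC sC /anticompleteP asC.
have {}asC c : c \in C -> ~~ e s c by apply: asC; rewrite inE.
have [/set0Pn[c cC0] connC] := connected_setP _ cC.
pose Z := nbh e s :\: Nbh e C; pose K := component_avoiding s c Z.
pose D (F : {set T}) := ~: (s |: nbh e s :|: \bigcup_(f in F) nbh e f).
have DP (F : {set T}) x :
    reflect [/\ x != s, ~~ e s x & forall f, f \in F -> ~~ e f x] (x \in D F).
  rewrite !inE !negb_or; apply: (iffP andP).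
    move=> [/andP[xs esx] /bigcupP nx]; split=> // f fF; apply/negP => efx.
    by apply: nx; exists f; rewrite // inE.
  move=> [xs esx Fx]; rewrite xs esx; split=> //.
  by apply/bigcupP => -[f fF]; rewrite inE (negbTE (Fx f fF)).
have ZC z : z \in Z -> forall x, x \in C -> ~~ e z x.
  case/setDP => ezs zNC x xC; apply: contra zNC => ezx; apply/NbhP.
  split; last by exists x; rewrite // e_sym.
  by apply/negP => /asC; move: ezs; rewrite inE => ->.
have sCD : C \subset D Z.
  apply/subsetP => x xC; apply/DP; split; rewrite ?asC //.
    by apply: contraNneq sC => <-.
  by move=> z zZ; apply: ZC.
have cD : c \in D Z by apply: (subsetP sCD).
have cK : c \in K by rewrite inE connect0.
have sKD : K \subset D Z.
  apply/subsetP => x; rewrite inE => cx; apply: (@connect_inv (fun y => y \in D Z) _ _ _ _ cx) => //.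
  by move=> u v _ /andP[/andP[]].
have sCK : C \subset K.
  by apply/subsetP => x xC; rewrite inE; apply: sub_connect_induced (connC _ _ cC0 xC).
have cK' : connected_set e K by apply: connected_component.
pose R := Nbh e K :\: (s |: nbh e s).
have RP r : r \in R -> [/\ r \notin K, r != s, ~~ e s r & exists2 u, u \in K & e u r].
  by case/setDP => /NbhP[rK Kr]; rewrite in_setU1 inE negb_or => /andP[rs esr].
(* A boundary vertex of [K] outside N[s] with no neighbor in [Z] would not have been removed, hence
   would lie in [K]. *)
have RZ r : r \in R -> exists2 z, z \in Z & e z r.
  case/RP => rK rs esr [u uK eur]; apply/exists_inP; apply: contraNT rK => /exists_inPn nZ.
  have rD : r \in D Z by apply/DP.
  move: (uK); rewrite !inE => cu; apply: connect_trans cu (connect1 _).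
  by rewrite /induced /= rD eur (subsetP sKD).
have sK : s \notin K by apply/negP => /(subsetP sKD)/DP[]; rewrite eqxx.
(* The creature has sides [[set s]] and [K]: [Z] attaches to [s] and misses [K], while [R] attaches
   to [K] and misses [s]. *)
have [|||||||||F [FZ Fk FR]] := @dominating_lt k [set s] K Z R k_gt0 cfree.
- exact: connected_set1.
- by [].
- by rewrite disjoints1.
- by apply/anticompleteP => _ b /set1P-> /(subsetP sKD)/DP[].
- apply/anticompleteP => a z /(subsetP sKD)/DP[_ _ na] zZ.
  by rewrite e_sym na.
- by apply/anticompleteP => _ r /set1P-> /RP[].
- by move=> z /setDP[]; rewrite inE => esz _; exists s; rewrite ?inE // e_sym.
- by move=> r /RP[_ _ _ [u uK eur]]; exists u; rewrite // e_sym.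
- exact: RZ.
have sDD : D Z \subset D F.
  apply/subsetP => x /DP[xs esx Zx]; apply/DP; split=> // f fF.
  by apply: Zx; apply: (subsetP FZ).
(* Shrinking [Z] to [F] removes fewer vertices, but [F] still dominates the boundary [R], so the
   component cannot grow past [K]. *)
have KE : component_avoiding s c F = K.
  apply/eqP; rewrite eqEsubset; apply/andP; split; apply/subsetP => x.
    rewrite inE => cx; apply: (@connect_inv (fun y => y \in K) _ _ _ _ cx) => //.
    move=> u v uK /andP[/andP[_ /DP[vs esv Fv]] euv].
    apply: contraT => vK; have vR : v \in R.
      by apply/setDP; split; [apply/NbhP; split=> //; exists u|rewrite !inE negb_or vs].
    by have [f fF] := FR v vR; rewrite (negbTE (Fv f fF)).
  by rewrite [x \in K]inE inE; apply: sub_connect_induced.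
exists c, F => //; rewrite /trace KE; apply/setP => w.
rewrite in_setI [RHS]in_setI inE; case esw: (e s w) => //=.
apply/NbhP/NbhP => -[wC [u uC euw]]; split.
- by apply/negP => /(subsetP sKD)/DP[_]; rewrite esw.
- by exists u => //; apply: (subsetP sCK).
- by apply/negP => /asC; rewrite esw.
(* A neighbor of [s] outside N(C) lies in [Z], and [K] contains no neighbor of [Z]; so [K] and [C]
   have the same trace. *)
have [|wNC] := boolP (w \in Nbh e C); first by case/NbhP.
have wZ : w \in Z by apply/setDP; rewrite inE.
by have [_ _ /(_ w wZ)] := DP _ _ (subsetP sKD u uC); rewrite e_sym euw.
Qed.

Lemma small_setP (V : finType) m (U : {set V}) : #|U| <= m ->
  exists f : {ffun 'I_m -> option V}, U = [set x | [exists i, f i == Some x]].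
Proof.
move=> Um; exists [ffun i : 'I_m => onth (enum U) i].
apply/setP => x; rewrite inE; apply/idP/existsP => [xU|[i]].
  have ix : index x (enum U) < m.
    by apply: leq_trans Um; rewrite cardE index_mem mem_enum.
  exists (Ordinal ix); rewrite ffunE /= onthE (nth_map x).
    by rewrite nth_index ?mem_enum.
  by rewrite index_mem mem_enum.
rewrite ffunE => /eqP onx; have := onthTE (enum U) i; rewrite onx => /esym lt_i.
by rewrite -mem_enum -(onth_nth x _ _ _ onx) mem_nth.
Qed.

(* [None] lets a function on ['I_k] enumerate sets of size at most [k], and
   [set0] serves as padding in unions of fewer than [m] traces. *)
Definition traces k : {set {set T}} :=
  set0 |: [set trace c.1.1 c.1.2 [set x | [exists i, c.2 i == Some x]]
          | c : T * T * {ffun 'I_k -> option T}].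

Lemma card_traces k : #|traces k| <= #|T|.+1 ^ k.+2.
Proof.
apply: leq_trans (leq_card_setU _ _) _.
rewrite cards1; apply: leq_trans (leq_add (leqnn 1) (leq_imset_card _ _)) _.
rewrite !card_prod card_ffun card_option card_ord.
have M0 : 0 < #|T|.+1 ^ k by rewrite expn_gt0.
rewrite !expnS mulnA; set M := _ ^ k in M0 *.
(* The gap between the squares of [#|T|] and [#|T|.+1] absorbs the extra element [set0]. *)
apply: leq_trans (leq_mul (ltn_mul (ltnSn #|T|) (ltnSn #|T|)) (leqnn M)).
by rewrite mulSn leq_add2r.
Qed.

Lemma mem_traces k s (C : {set T}) :
    0 < k -> creature_free e k ->
    connected_set e C -> s \notin C -> anticomplete e [set s] C ->
  nbh e s :&: Nbh e C \in traces k.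
Proof.
move=> k0 cfree cC sC asC.
have [c [F Fk ->]] := trace_connected k0 cfree cC sC asC.
have [f ->] := small_setP (ltnW Fk).
by rewrite in_setU1; apply/orP; right; apply/imsetP; exists (s, c, f).
Qed.

Definition unions m (FF : {set {set T}}) : {set {set T}} :=
  [set \bigcup_i f i | f : {ffun 'I_m -> {set T}} in ffun_on (mem FF)].

Lemma card_unions m FF : #|unions m FF| <= #|FF| ^ m.
Proof.
by apply: leq_trans (leq_imset_card _ _) _; rewrite card_ffun_on card_ord.
Qed.

Lemma mem_unions m (FF : {set {set T}}) (I : {set T}) (M : T -> {set T}) :
    #|I| <= m -> set0 \in FF -> (forall s, s \in I -> M s \in FF) ->
  \bigcup_(s in I) M s \in unions m FF.
Proof.
move=> Im FF0 MFF; have [f defI] := small_setP Im.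
pose g : {ffun 'I_m -> {set T}} :=
  [ffun i => if f i is Some s then M s else set0].
apply/imsetP; exists g.
  apply/ffun_onP => i; rewrite ffunE; case fi: (f i) => [s|] //; apply: MFF.
  by rewrite defI inE; apply/existsP; exists i; rewrite fi.
apply/setP => x; apply/bigcupP/bigcupP => -[].
  move=> s; rewrite defI inE => /existsP[i /eqP fi] xM; exists i => //.
  by rewrite ffunE fi.
move=> i _; rewrite ffunE; case fi: (f i) => [s|] xM; last by rewrite inE in xM.
by exists s => //; rewrite defI inE; apply/existsP; exists i; rewrite fi.
Qed.

(** * Distance levels within one side of a separator *)

(** For [r] in [A] this is the ball of radius [i] around [r] in the metric of G[A]. *)
Definition ball (A : {set T}) r i : {set T} :=
  iter i (fun X => X :|: (A :&: Nbh e X)) [set r].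

Definition touches (C : {set T}) t := [exists u in C, e u t].

Section Sides.

Variables (k : nat) (A B S : {set T}) (r : T).
Hypotheses (k_gt0 : 0 < k) (cfree : creature_free e k).
Hypotheses (cA : connected_set e A) (cB : connected_set e B).
Hypotheses (dAB : [disjoint A & B]) (aAB : anticomplete e A B).
Hypotheses (NA : Nbh e A = S) (NB : Nbh e B = S) (rA : r \in A).

Local Notation ball := (ball A r).

Lemma ball_sub i : ball i \subset A.
Proof.
elim: i => [|i IHi] /=; first by rewrite sub1set.
by rewrite subUset IHi subsetIl.
Qed.

Lemma ball_mono i j : i <= j -> ball i \subset ball j.
Proof.
move=> /subnK <-; elim: (j - i) => //= n IHn.
exact: subset_trans IHn (subsetUl _ _).
Qed.

Lemma ball_connected i : connected_set e (ball i).
Proof.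
elim: i => [|i IHi] /=; first exact: connected_set1.
apply: (@connected_setU _ _ r) IHi _.
  by rewrite (subsetP (ball_mono (leq0n i))) ?inE.
by move=> b /setIP[_ /NbhP[]].
Qed.

Lemma ball_step i x y : x \in ball i -> y \in A -> e x y -> y \in ball i.+1.
Proof.
move=> xi yA exy; rewrite /= in_setU; case yi: (y \in ball i) => //=.
by rewrite in_setI yA; apply/NbhP; rewrite yi; split=> //; exists x.
Qed.

Lemma ball_cover x : x \in A -> exists i, x \in ball i.
Proof.
move=> xA; have [_ /(_ r x rA xA) rx] := connected_setP _ cA.
apply: (connect_inv (P := fun y => exists i, y \in ball i) _ rx); last first.
  by exists 0; rewrite inE.
move=> u v [i ui] /andP[/andP[_ vA] euv].
by exists i.+1; apply: ball_step euv.
Qed.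

Lemma SnA t : t \in S -> t \notin A.
Proof. by rewrite -NA => /NbhP[]. Qed.

Lemma S_touches_B t : t \in S -> exists2 b, b \in B & e t b.
Proof. by rewrite -NB => /NbhP[_ [b bB ebt]]; exists b; rewrite // e_sym. Qed.

Lemma touches_mono i j t : i <= j -> touches (ball i) t -> touches (ball j) t.
Proof.
move=> ij /exists_inP[u ui eut]; apply/exists_inP; exists u => //.
exact: subsetP (ball_mono ij) u ui.
Qed.

(** The balls exhaust the connected set [A] and S = N(A), so some ball touches each [t] in [S]; the
    least such radius is its level. Off [S] the value 0 is a placeholder. *)
Lemma level_exists : exists d : T -> nat, forall t, t \in S ->
  touches (ball (d t)) t /\ forall i, i < d t -> ~~ touches (ball i) t.
Proof.
apply: (fin_all_exists (P := fun t d => t \in S -> touches (ball d) t /\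
  forall i, i < d -> ~~ touches (ball i) t)) => t.
have [tS|_] := boolP (t \in S); last by exists 0.
have ex : exists i, touches (ball i) t.
  move: tS; rewrite -NA => /NbhP[_ [u uA eut]]; have [i ui] := ball_cover uA.
  by exists i; apply/exists_inP; exists u.
exists (ex_minn ex) => _; case: ex_minnP => m tm min_m; split=> // i im.
by apply/negP => /min_m; rewrite leqNgt im.
Qed.

(* [B] attaches to all of [S], so [ball i] and [B] are the two sides of the
   creature. *)
Lemma level_dominated i : exists U : {set T}, [/\ U \subset A, #|U| <= k &
  forall t, t \in S -> touches (ball i) t ->
    (forall j, j < i -> ~~ touches (ball j) t) -> exists2 u, u \in U & e u t].
Proof.
case: i => [|i].
  (* At level 0 the root dominates alone. For k = 1 this singleton breaks the strict bound, hence
     the weak bound in the statement. *)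
  exists [set r]; rewrite cards1 sub1set; split=> // t _ /exists_inP[u ur eut] _.
  by exists u.
pose P := ball i.+1 :\: ball i.
pose R := [set t in S | touches (ball i.+1) t && ~~ touches (ball i) t].
have sPA : P \subset A := subset_trans (subsetDl _ _) (ball_sub _).
have /anticompleteP aABp := aAB.
have [|||||||||U [UP Uk UR]] := @dominating_lt k (ball i) B P R k_gt0 cfree.
- exact: ball_connected.
- exact: cB.
- by apply: disjointWl dAB; apply: ball_sub.
- by apply/anticompleteP => a b /(subsetP (ball_sub i)); apply: aABp.
- by apply/anticompleteP => b p bB /(subsetP sPA) pA; rewrite e_sym aABp.
- apply/anticompleteP => a t ai; rewrite inE => /and3P[_ _ /exists_inPn nt].
  exact: nt.
- move=> p /setDP[/setUP[->//|/setIP[_ /NbhP[_ [u ui eup]]]] _].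
  by exists u; rewrite // e_sym.
- by move=> t; rewrite inE => /andP[tS _]; apply: S_touches_B.
- move=> t; rewrite inE => /and3P[_ /exists_inP[u ui eut] /exists_inPn nt].
  by exists u => //; apply/setDP; split=> //; apply/negP => /nt; rewrite eut.
exists U; split; [exact: subset_trans sPA|exact: ltnW|].
by move=> t tS ti1 /(_ i (ltnSn i)) nti; apply: UR; rewrite inE tS ti1.
Qed.

(* The sides of the creature are now [s] and [ball i]; the gap between [i] and
   [i.+1] keeps the neighbors of [s] in [A] away from [ball i]. *)
Lemma common_dominated s i : s \in S -> ~~ touches (ball i.+1) s ->
  exists U : {set T}, [/\ U \subset ~: S, #|U| <= k &
    forall t, t \in S -> touches (ball i) t -> ~~ e s t ->
      [exists v in ~: S, e v s && e v t] -> exists2 u, u \in U & e u t].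
Proof.
move=> sS nsi; have nsi' := contra (touches_mono (leqnSn i)) nsi.
move/exists_inPn in nsi; move/exists_inPn in nsi'.
pose P := nbh e s :\: S.
pose R := [set t in S | [&& touches (ball i) t, ~~ e s t &
             [exists v in ~: S, e v s && e v t]]].
have [|||||||||U [UP Uk UR]] := @dominating_lt k [set s] (ball i) P R k_gt0 cfree.
- exact: connected_set1.
- exact: ball_connected.
- by rewrite disjoints1; apply: contra (SnA sS); apply: (subsetP (ball_sub i)).
- by apply/anticompleteP => _ b /set1P-> bi; rewrite e_sym nsi'.
- apply/anticompleteP => b v bi /setDP[]; rewrite inE => esv vS.
  (* A neighbor [v] of [ball i] is either in [A], hence in [ball i.+1], which does not touch [s], or
     in N(A) = S. *)
  apply/negP => ebv; have [vA|vA] := boolP (v \in A).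
    by have := nsi v (ball_step bi vA ebv); rewrite e_sym esv.
  move/negP: vS; apply; rewrite -NA; apply/NbhP; split=> //; exists b => //.
  exact: (subsetP (ball_sub i)).
- by apply/anticompleteP => _ t /set1P->; rewrite inE => /and4P[].
- by move=> v /setDP[]; rewrite inE => esv _; exists s; rewrite ?inE // e_sym.
- move=> t; rewrite inE => /and4P[_ /exists_inP[u ui eut] _ _].
  by exists u; rewrite // e_sym.
- move=> t; rewrite inE => /and4P[_ _ _ /exists_inP[v vS /andP[evs evt]]].
  by exists v => //; apply/setDP; rewrite inE e_sym; split=> //; rewrite inE in vS.
exists U; split; [|exact: ltnW|].
  by apply: subset_trans UP _; rewrite /P setDE subsetIr.
by move=> t tS ti nst cst; apply: UR; rewrite inE tS ti nst.
Qed.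

(** May hold between a vertex and itself; it is only required to fail for distinct vertices. *)
Definition conflict : rel T :=
  [rel s t | e s t || [exists v in ~: S, e v s && e v t]].

(** Three dominating sets of size at most [k] make up [QX.1]: one for level [d s], one for the level
    just below, one for lower vertices sharing an outside neighbor with [s]. The lower vertices
    adjacent to [s] form part of the trace [QX.2]. *)
Lemma conflict_dominated (d : T -> nat) s :
    (forall t, t \in S -> touches (ball (d t)) t /\
       forall i, i < d t -> ~~ touches (ball i) t) ->
    s \in S ->
  exists QX : {set T} * {set T},
    [/\ QX.1 \subset ~: S, #|QX.1| <= 3 * k, QX.2 \in traces k,
        QX.2 \subset A :|: S &
        forall t, t \in S -> d t <= d s -> s = t \/ conflict s t ->
          t \in QX.2 \/ exists2 v, v \in QX.1 & e v t].
Proof.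
move=> dP sS; have [_ ds] := dP s sS.
have sAS : A \subset ~: S.
  by apply/subsetP => a aA; rewrite inE; apply: contraL aA; apply: SnA.
have [U1 [U1A U1k U1P]] := level_dominated (d s).
have [U2 [U2A U2k U2P]] := level_dominated (d s).-1.
have [U3 [X [U3S U3k Xk XS XP]]] : exists U3 X : {set T},
    [/\ U3 \subset ~: S, #|U3| <= k, X \in traces k, X \subset A :|: S &
        forall t, t \in S -> d t < (d s).-1 -> conflict s t ->
          t \in X \/ exists2 v, v \in U3 & e v t].
  (* For [d s] at most 1 the truncated predecessor is 0, so there is no lower vertex to treat. *)
  case dsE: (d s) => [|[|i]] /=.
  - by exists set0, set0; rewrite !sub0set cards0 setU11; split.
  - by exists set0, set0; rewrite !sub0set cards0 setU11; split.
  have nsi : ~~ touches (ball i.+1) s by apply: ds; rewrite dsE.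
  have nsi' := contra (touches_mono (leqnSn i)) nsi.
  have [U [US Uk UP]] := common_dominated sS nsi.
  exists U, (nbh e s :&: Nbh e (ball i)); split=> //.
  - apply: mem_traces => //; first exact: ball_connected.
      by apply: contra (SnA sS); apply: (subsetP (ball_sub i)).
    apply/anticompleteP => _ b /set1P-> bi; rewrite e_sym.
    by move/exists_inPn: nsi'; apply.
  - apply/subsetP => t /setIP[_ /NbhP[_ [u ui eut]]]; rewrite in_setU.
    case tA: (t \in A) => //=; rewrite -NA; apply/NbhP; rewrite tA; split=> //.
    by exists u => //; apply: (subsetP (ball_sub i)).
  move=> t tS dt; have ti := touches_mono (dt : d t <= i) (dP t tS).1.
  rewrite /conflict /=; case est: (e s t) => /= cst; last first.
    by right; apply: UP; rewrite ?est.
  left; rewrite in_setI inE est; apply/NbhP; split; last exact/exists_inP.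
  by apply: contra (SnA tS); apply: (subsetP (ball_sub i)).
exists (U1 :|: U2 :|: U3, X); split=> //=.
- by rewrite !subUset U3S !(subset_trans _ sAS).
- apply: leq_trans (leq_card_setU _ _) _; rewrite mulSnr mul2n -addnn.
  apply: leq_add U3k; apply: leq_trans (leq_card_setU _ _) _.
  exact: leq_add.
move=> t tS dts st; have [tt nt] := dP t tS.
have [dt|dt1] := eqVneq (d t) (d s).
  right; rewrite dt in tt nt; have [u uU eut] := U1P t tS tt nt.
  by exists u => //; rewrite !inE uU.
have [dt|dt2] := eqVneq (d t) (d s).-1.
  right; rewrite dt in tt nt; have [u uU eut] := U2P t tS tt nt.
  by exists u => //; rewrite !inE uU orbT.
have [st'|{}st] := st; first by rewrite st' eqxx in dt1.
have lt_ts : d t < d s by rewrite ltn_neqAle dt1.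
have dlt : d t < (d s).-1 by rewrite ltn_neqAle dt2 -ltnS (ltn_predK lt_ts).
have [tX|[u uU eut]] := XP t tS dlt st; [by left|right].
by exists u => //; rewrite !inE uU orbT.
Qed.

End Sides.

(** * Greedy conflict-free sets and the cover of a separator from one side *)

(** Pick a vertex maximizing [d], discard it and everything in relation [c] with it, and recurse;
    whatever is discarded has level at most that of the vertex picked. *)
Lemma greedy_kernel (d : T -> nat) (c : rel T) (S : {set T}) :
    symmetric c ->
  exists I : {set T}, [/\ I \subset S,
    {in I &, forall s t, s != t -> ~~ c s t} &
    forall t, t \in S ->
      exists2 s, s \in I & d t <= d s /\ (s = t \/ c s t)].
Proof.
move=> c_sym; have [n] := ubnP #|S|; elim: n S => // n IHn S ltSn.
have [->|[s0 s0S]] := set_0Vmem S.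
  by exists set0; split=> [|s t|t]; rewrite ?sub0set ?inE.
case: (arg_maxnP (P := [in S]) d s0S) => s sS0 max_s; have sS : s \in S := sS0.
pose S' := [set t in S | (t != s) && ~~ c s t].
have [|I [IS' indI domI]] := IHn S'.
  apply: leq_trans _ (_ : #|S| <= n); last by [].
  apply: proper_card; apply/properP; split.
    by apply/subsetP => t; rewrite inE => /andP[].
  by exists s; rewrite // inE eqxx andbF.
have Is t : t \in I -> ~~ c s t.
  by move/(subsetP IS'); rewrite inE => /and3P[].
exists (s |: I); split.
- rewrite subUset sub1set sS; apply/subsetP => t /(subsetP IS').
  by rewrite inE => /andP[].
- move=> x y /setU1P[->|xI] /setU1P[->|yI]; rewrite ?eqxx //.
  + by move=> _; apply: Is.
  + by move=> _; rewrite c_sym; apply: Is.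
  + exact: indI.
move=> t tS; have [tS'|] := boolP (t \in S').
  have [x xI xt] := domI t tS'; exists x => //.
  by rewrite in_setU1 xI orbT.
rewrite inE tS /= negb_and !negbK => st; exists s; first by rewrite setU11.
split; first exact: max_s.
by case/orP: st => [/eqP->|]; [left|right].
Qed.

Lemma card_bigcup_leq (I : {set T}) (Q : T -> {set T}) m :
  (forall s, s \in I -> #|Q s| <= m) -> #|\bigcup_(s in I) Q s| <= #|I| * m.
Proof.
move=> Qm; rewrite -sum_nat_const.
apply: (@leq_trans (\sum_(s in I) #|Q s|)); last exact: leq_sum.
elim/big_rec2: _ => [|s n X _ leXn]; first by rewrite cards0.
by apply: leq_trans (leq_card_setU _ _) _; rewrite leq_add2l.
Qed.

(** The two kinds of conflict are the two ways a subset of [S] can fail to be a candidate for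
    [zeta]: an inner edge, or an outside vertex seeing two members. *)
Lemma zeta_geq (S I : {set T}) :
    I \subset S -> {in I &, forall s t, s != t -> ~~ conflict S s t} ->
  #|I| <= zeta e S.
Proof.
move=> IS indI.
apply: (leq_bigmax_cond (F := fun I : {set T} => #|I|)).
rewrite IS /=; apply/andP; split.
  apply/forall_inP => s sI; apply/forall_inP => t tI.
  have [->|st] := eqVneq s t; first by rewrite e_irr.
  by have := indI s t sI tI st; rewrite negb_or => /andP[].
apply/forall_inP => v vS; apply/card_le1_eqP => s t.
rewrite !in_setI !inE => /andP[evs sI] /andP[evt tI].
apply/eqP; apply: contraT => st; have := indI s t sI tI.
rewrite eq_sym st negb_or => /(_ isT)/andP[_ /exists_inPn/(_ v vS)].
by rewrite evs evt.
Qed.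

(* [X] collects the elements of [S] reached only through an edge inside [S]; it
   may contain vertices of [A], which disappear when intersecting with the
   corresponding set for [B]. *)
Lemma one_sided_cover k L (A B S : {set T}) :
    0 < k -> creature_free e k -> connected_set e A -> connected_set e B ->
    [disjoint A & B] -> anticomplete e A B -> Nbh e A = S -> Nbh e B = S ->
    zeta e S <= L ->
  exists Q X : {set T}, [/\ Q \subset ~: S, #|Q| <= L * (3 * k),
    X \in unions L (traces k), X \subset A :|: S &
    forall t, t \in S -> t \in X \/ exists2 v, v \in Q & e v t].
Proof.
move=> k0 cfree cA cB dAB aAB NA NB zL.
have [/set0Pn[r rA] _] := connected_setP _ cA.
have [d dP] := level_exists cA NA rA.
have [QX QXP] : exists QX : T -> {set T} * {set T}, forall s, s \in S ->
    [/\ (QX s).1 \subset ~: S, #|(QX s).1| <= 3 * k, (QX s).2 \in traces k,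
        (QX s).2 \subset A :|: S &
        forall t, t \in S -> d t <= d s -> s = t \/ conflict S s t ->
          t \in (QX s).2 \/ exists2 v, v \in (QX s).1 & e v t].
  apply: (fin_all_exists (P := fun s (QX : {set T} * {set T}) => s \in S ->
    [/\ QX.1 \subset ~: S, #|QX.1| <= 3 * k, QX.2 \in traces k,
        QX.2 \subset A :|: S &
        forall t, t \in S -> d t <= d s -> s = t \/ conflict S s t ->
          t \in QX.2 \/ exists2 v, v \in QX.1 & e v t])) => s.
  have [sS|_] := boolP (s \in S); last by exists (set0, set0).
  have [QX QXP] := conflict_dominated k0 cfree cB dAB aAB NA NB rA dP sS.
  by exists QX.
have csym : symmetric (conflict S).
  move=> s t; rewrite /conflict /= e_sym; congr (_ || _).
  by apply: eq_existsb => v; rewrite (andbC (e v s)).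
have [I [IS indI domI]] := greedy_kernel d S csym.
have IL : #|I| <= L by apply: leq_trans zL; apply: zeta_geq.
have IQX s (sI : s \in I) := QXP s (subsetP IS s sI).
exists (\bigcup_(s in I) (QX s).1), (\bigcup_(s in I) (QX s).2); split.
- by apply/bigcupsP => s /IQX[].
- apply: leq_trans (card_bigcup_leq (m := 3 * k) _) _; first by move=> s /IQX[].
  by rewrite leq_mul2r IL orbT.
- by apply: mem_unions => // [|s /IQX[]//]; rewrite setU11.
- by apply/bigcupsP => s /IQX[].
move=> t tS; have [s sI [dts st]] := domI t tS.
have [_ _ _ _ /(_ t tS dts st)[tX|[v vQ evt]]] := IQX s sI.
  by left; apply/bigcupP; exists s.
by right; exists v => //; apply/bigcupP; exists s.
Qed.

(** * Encoding and counting minimal separators *)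

Lemma minimal_separatorP (S : {set T}) : minimal_separator e S ->
  exists A B, [/\ connected_set e A, connected_set e B, [disjoint A & B],
    anticomplete e A B & Nbh e A = S /\ Nbh e B = S].
Proof.
rewrite /minimal_separator => /card_gt1P[A [B [Afull Bfull neqAB]]].
have csym : {in ~: S & &, equivalence_rel (connect (induced e (~: S)))}.
  move=> x y z _ _ _; split; first exact: connect0.
  move=> xy; apply/idP/idP; apply: connect_trans => //.
  by rewrite sym_connect_sym //; apply: induced_sym.
have /and3P[_ /trivIsetP tI _] := equivalence_partitionP csym.
have comp C : C \in full_components e S ->
    [/\ connected_set e C, C \subset ~: S & Nbh e C = S].
  rewrite inE => /andP[/imsetP[c cS ->] /eqP NC].
  have sub y : connect (induced e (~: S)) c y -> y \in ~: S.
    move=> cy; apply: (@connect_inv (fun z => z \in ~: S) _ _ _ _ cy) cS.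
    by move=> u v _ /andP[/andP[]].
  have KE : [set y in ~: S | connect (induced e (~: S)) c y] =
            [set y | connect (induced e (~: S)) c y].
    by apply/setP => y; rewrite inE [RHS]inE andb_idl // => /sub.
  rewrite KE in NC *; split=> //; first exact: connected_component.
  by apply/subsetP => y; rewrite inE => /sub.
have [cA AS NA] := comp A Afull; have [cB BS NB] := comp B Bfull.
have dAB : [disjoint A & B].
  by apply: tI neqAB; [case/setIdP: Afull|case/setIdP: Bfull].
(* An edge from [A] to [B] would put its end [b] in N(A) = S. *)
exists A, B; split=> //; apply/anticompleteP => a b aA bB; apply/negP => eab.
have bS : b \notin S by have := subsetP BS b bB; rewrite inE.
move/negP: bS; apply; rewrite -NA; apply/NbhP; split; last by exists a.
by rewrite (disjointFl dAB).
Qed.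

(** A separator is decoded from four unions of traces: two of 3kL traces, from the dominating
    vertices for each side, and two of L traces, the sets [X] and [Y]. This gives the factor L(6k +
    2), each trace costing an exponent k + 2. *)
Lemma minimal_separators_leq k L :
    0 < k -> creature_free e k ->
  #|[set S : {set T} | minimal_separator e S && (zeta e S <= L)]|
    <= #|T|.+1 ^ (k.+2 * (L * (6 * k + 2))).
Proof.
move=> k0 cfree; pose U m := unions m (traces k).
pose m := L * (3 * k).
pose codes := setX (setX (U m) (U m)) (setX (U L) (U L)).
pose decode (c : {set T} * {set T} * ({set T} * {set T})) : {set T} :=
  c.1.1 :|: c.1.2 :|: (c.2.1 :&: c.2.2).
have cardU n : #|U n| <= #|T|.+1 ^ (k.+2 * n).
  apply: leq_trans (card_unions _ _) _; rewrite expnM.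
  by case: n => // n; rewrite leq_exp2r ?card_traces.
apply: leq_trans (_ : #|decode @: codes| <= _); last first.
  apply: leq_trans (leq_imset_card _ _) _; rewrite !cardsX.
  apply: leq_trans (leq_mul (leq_mul (cardU _) (cardU _))
                            (leq_mul (cardU _) (cardU _))) _.
  rewrite -!expnD leq_pexp2l // /m -[6]/(3 + 3) -[2]/(1 + 1) mulnDl !mulnDr.
  by rewrite !muln1.
apply: subset_leq_card; apply/subsetP => S; rewrite inE => /andP[minS zL].
have [A [B [cA cB dAB aAB [NA NB]]]] := minimal_separatorP minS.
have dBA : [disjoint B & A] by rewrite disjoint_sym.
have aBA : anticomplete e B A.
  apply/anticompleteP => b a bB aA; rewrite e_sym.
  by have /anticompleteP := aAB; apply.
have [Q [X [QS Qm XU XA SQX]]] := one_sided_cover k0 cfree cA cB dAB aAB NA NB zL.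
have [R [Y [RS Rm YU YB SRY]]] := one_sided_cover k0 cfree cB cA dBA aBA NB NA zL.
have trS v : v \in ~: S -> nbh e v :&: S \in traces k.
  rewrite inE => vS.
  have trC C : connected_set e C -> Nbh e C = S -> v \notin C ->
      nbh e v :&: S \in traces k.
    move=> cC NC vC; rewrite -NC; apply: mem_traces => //.
    apply/anticompleteP => _ c /set1P-> cC'; apply: contra vS => evc.
    by rewrite -NC; apply/NbhP; split=> //; exists c; rewrite // e_sym.
  (* A vertex [v] outside [S] misses at least one of the sides, and N(v) meets [S] in its trace on
     that side. *)
  have [vB|] := boolP (v \in B); last exact: trC.
  by apply: (trC A) => //; rewrite (disjointFl dAB).
have memU (I : {set T}) : I \subset ~: S -> #|I| <= m ->
    \bigcup_(v in I) (nbh e v :&: S) \in U m.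
  move=> IS Im; rewrite /U; apply: mem_unions => // [|v vI]; first by rewrite setU11.
  exact/trS/(subsetP IS).
apply/imsetP; exists (\bigcup_(v in Q) (nbh e v :&: S),
  \bigcup_(v in R) (nbh e v :&: S), (X, Y)); first by rewrite !in_setX !memU //= XU.
apply/eqP; rewrite eqEsubset /decode /= !subUset -andbA; apply/and4P; split.
- apply/subsetP => t tS; rewrite in_setU in_setI.
  have in_cover (I : {set T}) v : v \in I -> e v t -> t \in \bigcup_(v in I) (nbh e v :&: S).
    by move=> vI evt; apply/bigcupP; exists v; rewrite // in_setI inE evt.
  have [tX|[v vQ evt]] := SQX t tS; last by rewrite in_setU (in_cover Q v).
  have [tY|[v vR evt]] := SRY t tS; last by rewrite in_setU (in_cover R v) ?orbT.
  by rewrite tX tY orbT.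
- by apply/bigcupsP => v _; apply: subsetIr.
- by apply/bigcupsP => v _; apply: subsetIr.
(* As [A] and [B] are disjoint, the sets A + S and B + S meet only in [S]. *)
apply/subsetP => t /setIP[/(subsetP XA)+ /(subsetP YB)].
rewrite !in_setU => /orP[tA|//] /orP[tB|//].
by rewrite (disjointFr dAB tA) in tB.
Qed.

End CreatureFree.

Theorem theorem4 :
  exists C : nat, (0 < C)%N /\
    forall k L : nat, (0 < k)%N ->
      exists p : {poly int}, ((size p).-1 <= C * k ^ 3 * L)%N /\
        forall (T : finType) (e : rel T), symmetric e -> irreflexive e ->
          creature_free e k ->
          #|[set S : {set T} | minimal_separator e S && (zeta e S <= L)%N]|%:Z
            <= p.[#|T|%:Z].
Proof.
(* For k at least 1, k + 2 is at most 3k and 6k + 2 at most 8k, so the exponent is at most 24 k^2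
   L. *)
exists 24; split=> // k L k0.
exists (('X + 1%:P) ^+ (k.+2 * (L * (6 * k + 2)))); split.
  rewrite size_exp size_XaddC mul1n mulnCA [X in (_ <= X)%N]mulnC leq_mul2l.
  apply/orP; right; case: k k0 => // k _; rewrite !expnS expn0; nia.
move=> T e e_sym e_irr cfree.
rewrite horner_exp hornerD hornerX hornerC -PoszD addn1 -rmorphXn natrXE lez_nat.
exact: minimal_separators_leq.
Qed.
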